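(* For every $n\ge 1$, the distribution of $(\mathsf{des}_2,\mathsf{ear})$ over $\mathfrak{S}_n$ is symmetric, i.e., \[ \sum_{\pi\in \mathfrak{S}_n}q^{\mathsf{des}_2(\pi)}t^{\mathsf{ear}(\pi)}= \sum_{\pi\in \mathfrak{S}_n}q^{\mathsf{ear}(\pi)}t^{\mathsf{des}_2(\pi)} \] as polynomials in $q,t$.
   Context: $\mathfrak{S}_n$ is the set of permutations of $[n]=\{1,\dots,n\}$. For $\pi\in\mathfrak{S}_n$ and an index $i\in[n]$: $i$ is a descent if $i<n$ and $\pi(i)>\pi(i+1)$; $i$ is a record if $\pi(j)<\pi(i)$ for all $j<i$; $i$ is an antirecord if $\pi(j)>\pi(i)$ for all $j>i$ (so $i=n$ is always an antirecord); $i$ is a descent of type $2$ if it is both a descent and a record; $i$ is a cycle peak if $\pi(i)<i>\pi^{-1}(i)$; $i$ is an exclusive antirecord cycle peak if $i$ is a cycle peak and an antirecord but not a record. $\mathsf{des}_2(\pi)$ is the number of descents of type $2$ and $\mathsf{ear}(\pi)$ is the number of exclusive antirecord cycle peaks of $\pi$. *)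

(* Defs.v *)
From mathcomp Require Import all_boot all_order all_algebra all_fingroup.
From mathcomp Require Import mpoly.

Set Implicit Arguments.
Unset Strict Implicit.
Unset Printing Implicit Defensive.

(* Permutations of [n] are elements of 'S_n, acting on {0, ..., n - 1}: every
   index and every value is shifted down by one, which affects none of the
   comparisons below. *)

Section PermStatistics.
Variable n : nat.
Implicit Types (s : 'S_n) (i : 'I_n).

Definition descent s i : bool :=
  [exists j : 'I_n, (j == i.+1 :> nat) && (s j < s i)%N].

Definition record s i : bool := [forall j : 'I_n, (j < i)%N ==> (s j < s i)%N].

Definition antirecord s i : bool :=
  [forall j : 'I_n, (i < j)%N ==> (s i < s j)%N].

Definition descent2 s i : bool := descent s i && record s i.

Definition cycle_peak s i : bool := (s i < i)%N && ((s^-1)%g i < i)%N.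

Definition excl_antirecord_cycle_peak s i : bool :=
  [&& cycle_peak s i, antirecord s i & ~~ record s i].

Definition des2 s : nat := #|[set i | descent2 s i]|.

Definition ear s : nat := #|[set i | excl_antirecord_cycle_peak s i]|.

End PermStatistics.

Definition var_q : {mpoly int[2]} := 'X_(@Ordinal 2 0 isT).
Definition var_t : {mpoly int[2]} := 'X_(@Ordinal 2 1 isT).

(* Main.v *)
Require Import Defs.
From mathcomp Require Import all_boot all_order all_algebra all_fingroup.
From mathcomp Require Import mpoly zify ring.

(** Reading a permutation from left to right and recording, for each index i,
    whether i <= s i, whether s^-1 i <= i, and a Lehmer-type code, turns
    permutations into weighted Motzkin paths (Laguerre histories). Position i is
    a record iff i <= s i and its code is 0, and i contributes to ear iff it is a
    down step with code 0, while des2 counts the record letters that are followed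
    by a non-record letter. With c = q - 1 and d = t - 1, let X (resp. N) be the
    transfer operator of the record (resp. non-record) letters, acting on
    polynomials in x, where x^h stands for height h:
      X = y,  N = y^2 D + d S,  y = 1 + x,  D = d/dx,  S f = (f - f(0)) / x.
    The generating function in z is the constant term of
    (1 - z (X + N) - c z^2 N X)^-1 applied to 1. If g is this series, then
      f(x) = J g(k x J),  J = 1 / (1 - c z x),  k = 1 + c z,
    has the same constant term and solves
      (1 - z (X + N + c x)) f + c d z^2 (f - f(0)) = 1.
    The constant term of f is a continued fraction symmetric in q and t: its
    level steps have weight 2 h + 1, its double level steps have weight - c d at
    heights h >= 1, and its up and down steps between heights h and h + 1 have
    the product weight (q + h) (t + h). The formal proof is the transpose of this
    computation: it applies the functional that sends x^h to the generating
    function of the paths from height h to 0. *)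

Set Implicit Arguments.
Unset Strict Implicit.
Unset Printing Implicit Defensive.

Import GRing.Theory.

(** * The continued fraction symmetric in q and t *)

Section SymmetricHistories.
Local Open Scope ring_scope.
Variable R : comNzRingType.

(* In sym_hist q t n h the index n is the exponent of z shifted by one, the value
   at n = 0 being 0; h is the height from which a path goes down to 0. *)
Fixpoint sym_hist (q t : R) (n : nat) : nat -> R :=
  match n with
  | 0 => fun=> 0
  | n1.+1 => match n1 with
    | 0 => fun h => (h == 0)%:R
    | n2.+1 => fun h =>
        (q + h%:R) * sym_hist q t n1 h.+1 + (h%:R *+ 2 + 1) * sym_hist q t n1 h
        + (if h is h1.+1 then
             (t + h1%:R) * sym_hist q t n1 h1
             - (q - 1) * (t - 1) * sym_hist q t n2 h
           else 0)
    end
  end.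

Lemma sym_histSS q t n h : sym_hist q t n.+2 h =
  (q + h%:R) * sym_hist q t n.+1 h.+1
  + (h%:R *+ 2 + 1) * sym_hist q t n.+1 h
  + (if h is h1.+1 then
       (t + h1%:R) * sym_hist q t n.+1 h1 - (q - 1) * (t - 1) * sym_hist q t n h
     else 0).
Proof. by []. Qed.

Lemma sym_hist1 q t h : sym_hist q t 1 h = (h == 0)%:R.
Proof. by []. Qed.

Arguments sym_hist : simpl never.

(* After rescaling height h by q (q + 1) ... (q + h - 1), the weights of an up
   step and of the matching down step are merged into (q + h) (t + h), so that
   the recursion becomes symmetric in q and t. *)
Lemma sym_hist_gauge q t n h :
  (\prod_(i < h) (q + i%:R)) * sym_hist q t n h
  = (\prod_(i < h) (t + i%:R)) * sym_hist t q n h.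
Proof.
elim/ltn_ind: n h => -[|[|n]] IH h.
- by rewrite !mulr0.
- by rewrite !sym_hist1; case: h => [|h]; rewrite ?big_ord0 ?mulr0.
rewrite !sym_histSS.
have := IH n.+1 (leqnn _) h.+1; rewrite !big_ord_recr /= => e1.
have e2 := IH n.+1 (leqnn _) h.
case: h e1 e2 => [|h] e1 e2.
  by move: e1 e2; rewrite !big_ord0 !mul1r => e1 e2; rewrite e1 e2.
have e3 := IH n.+1 (leqnn _) h.
have e4 := IH n (leqnSn _) h.+1.
move: e1 e2 e3 e4; rewrite !big_ord_recr /=.
set a := \prod_(i < h) _; set b := \prod_(i < h) _.
move=> e1 e2 e3 e4.
transitivity (a * (q + h%:R) * (q + h.+1%:R) * sym_hist q t n.+1 h.+2
  + (h.+1%:R *+ 2 + 1) * (a * (q + h%:R) * sym_hist q t n.+1 h.+1)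
  + (q + h%:R) * (t + h%:R) * (a * sym_hist q t n.+1 h)
  - (q - 1) * (t - 1) * (a * (q + h%:R) * sym_hist q t n h.+1)); first by ring.
by rewrite e1 e2 e3 e4; ring.
Qed.

Lemma sym_hist_sym q t n : sym_hist q t n 0 = sym_hist t q n 0.
Proof. by have := sym_hist_gauge q t n 0; rewrite !big_ord0 !mul1r. Qed.

(** * The substitution x -> k x J, transposed *)

Variables q t : R.
Let c : R := q - 1.
Let d : R := t - 1.

(* Let l be the functional x^h |-> sum_n (sym_hist q t n.+1 h) z^n. Then
   [dilated] and [moment] list the coefficients of l (x^h J^b) and
   l (k^a x^h J^b). *)
Fixpoint dilated (n h b : nat) : R :=
  match n with
  | 0 => 0
  | n1.+1 => sym_hist q t n h + c * \sum_(i < b) dilated n1 h.+1 i.+1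
  end.

Fixpoint moment (n a h b : nat) {struct a} : R :=
  if a is a1.+1 then moment n a1 h b + c * moment n.-1 a1 h b
  else dilated n h b.

Local Notation D := dilated.
Local Notation E := moment.

Lemma dilated_b0 n h : D n h 0 = sym_hist q t n h.
Proof. by case: n => [|n] //=; rewrite big_ord0 mulr0 addr0. Qed.

Lemma dilatedS n h b : D n h b.+1 = D n h b + c * D n.-1 h.+1 b.+1.
Proof.
case: n => [|n]; first by rewrite /= mulr0 addr0.
by rewrite /= big_ord_recr mulrDr addrA.
Qed.

Lemma dilated_n1 h b : D 1 h b = (h == 0)%:R.
Proof. by rewrite /= big1 ?mulr0 ?addr0. Qed.

Lemma dilated_n0 h b : D 0 h b = 0.
Proof. by []. Qed.

Arguments dilated : simpl never.

Lemma moment_n0 a h b : E 0%N a h b = 0.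
Proof. by elim: a => //= a ->; rewrite mulr0 addr0. Qed.

Lemma moment_n1 a h b : E 1%N a h b = (h == 0)%:R.
Proof. by elim: a => [|a /= ->]; rewrite /= ?dilated_n1 // moment_n0 mulr0 addr0. Qed.

Lemma momentK n a h b : E n a.+1 h b = E n a h b + c * E n.-1 a h b.
Proof. by []. Qed.

Lemma moment_a0 n h b : E n 0%N h b = D n h b.
Proof. by []. Qed.

Arguments moment : simpl never.

Lemma momentJ n a h b : E n a h b.+1 = E n a h b + c * E n.-1 a h.+1 b.+1.
Proof.
elim: a n => [|a IH] n; first exact: dilatedS.
by rewrite !momentK !IH; ring.
Qed.

(** The symmetric equation at x^(h+1) J^b; the terms with factor b come from D (J^b) = b c z
    J^(b+1). *)
Lemma dilated_rec n h b : D n.+2 h.+1 b =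
  h.+1%:R * (D n.+1 h b + 2%:R * D n.+1 h.+1 b + D n.+1 h.+2 b)
  + b%:R * c * (D n h.+1 b.+1 + 2%:R * D n h.+2 b.+1 + D n h.+3 b.+1)
  + D n.+1 h.+1 b + D n.+1 h.+2 b + c * D n.+1 h.+2 b + d * D n.+1 h b
  - c * d * D n h.+1 b.
Proof.
elim: n h b => [|n IHn] h b.
  elim: b => [|b IHb]; first by rewrite !dilated_b0 sym_histSS /c /d /=; ring.
  by rewrite dilatedS IHb /= !dilated_n1 !dilated_n0 /=; ring.
elim: b => [|b IHb]; first by rewrite !dilated_b0 sym_histSS /c /d; ring.
rewrite dilatedS IHb /= [in LHS](IHn h.+1 b.+1).
rewrite (dilatedS n.+1 h.+1 b.+1) (dilatedS n.+1 h.+2 b.+1) (dilatedS n.+1 h.+3 b.+1).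
rewrite (dilatedS n.+2 h b) (dilatedS n.+2 h.+1 b) (dilatedS n.+2 h.+2 b) /=.
by rewrite (dilatedS n.+1 h.+1 b) /=; ring.
Qed.

(** The same equation at J, whose constant term 1 leaves the extra term c d z^2. *)
Lemma dilated_rec0 n : D n.+2 0 1 =
  c * (D n 0 2 + 2%:R * D n 1 2 + D n 2 2)
  + D n.+1 0 1 + (1 + c) * D n.+1 1 1 + c * d * D n 0 0.
Proof.
case: n => [|n].
  rewrite dilatedS dilated_b0 sym_histSS /= !dilated_n1 !dilated_n0 !sym_hist1.
  by rewrite /c /=; ring.
rewrite dilatedS dilated_b0 sym_histSS /= [in LHS]dilated_rec.
rewrite (dilatedS n.+1 0 1) (dilatedS n.+1 1 1) (dilatedS n.+1 2 1).
rewrite (dilatedS n.+2 0 0) (dilatedS n.+2 1 0) /=.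
rewrite (dilatedS n.+1 0 0) (dilatedS n.+1 1 0) (dilatedS n.+1 2 0) /=.
by rewrite !dilated_b0 /c; ring.
Qed.

Lemma moment_rec n a h b : E n.+2 a h.+1 b =
  h.+1%:R * (E n.+1 a h b + 2%:R * E n.+1 a h.+1 b + E n.+1 a h.+2 b)
  + b%:R * c * (E n a h.+1 b.+1 + 2%:R * E n a h.+2 b.+1 + E n a h.+3 b.+1)
  + E n.+1 a h.+1 b + E n.+1 a h.+2 b + c * E n.+1 a h.+2 b + d * E n.+1 a h b
  - c * d * E n a h.+1 b.
Proof.
elim: a n => [|a IH] n; first exact: dilated_rec.
case: n => [|n]; last by rewrite !momentK !IH /=; ring.
by rewrite !momentK !IH !moment_n1 !moment_n0 /=; ring.
Qed.

(* The relations J = 1 + c z x J and k = 1 + c z, and their consequences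
   (1 + x) J = 1 + k x J and k J = 1 + c z (1 + k x J), under the functional. *)
Let defJ n a h b := E n a h b.+1 - E n a h b - c * E n.-1 a h.+1 b.+1.
Let def1x n a h b :=
  E n a h b.+1 + E n a h.+1 b.+1 - E n a h b - E n a.+1 h.+1 b.+1.
Let defkJ n a h b := E n a.+1 h b.+1 - E n a h b
  - c * (E n.-1 a h b + E n.-1 a.+1 h.+1 b.+1).

Lemma defJ0 n a h b : defJ n a h b = 0.
Proof. by rewrite /defJ momentJ; ring. Qed.

Lemma def1x0 n a h b : def1x n a h b = 0.
Proof. by rewrite /def1x momentK [E n a h b.+1]momentJ; ring. Qed.

Lemma defkJ0 n a h b : defkJ n a h b = 0.
Proof. by rewrite /defkJ momentJ [E n a.+1 h b]momentK; ring. Qed.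

(* The coefficients of l ((k x J)^h). *)
Definition subst_hist n h := E n h h h.
Local Notation M := subst_hist.

(** Transpose of N: the coefficient of x^h1 in N x^(h1+1) is h1 + 1 + d = h1 + t. *)
Definition nonrec_step (f : nat -> R) h : R :=
  h%:R * f h.+1 + h%:R * 2%:R * f h
  + (if h is h1.+1 then (h1%:R + t) * f h1 else 0).

Lemma subst_hist_rec n h : M n.+2 h = M n.+1 h.+1 + M n.+1 h
  + nonrec_step (M n.+1) h
  + c * (nonrec_step (M n) h.+1 + nonrec_step (M n) h).
Proof.
case: h => [|h].
  transitivity (M n.+1 1 + M n.+1 0 + nonrec_step (M n.+1) 0
    + c * (nonrec_step (M n) 1 + nonrec_step (M n) 0)
    - (defJ n.+2 0 0 0 - def1x n.+1 0 0 0
       - c * (def1x n 0 0 1 + def1x n 0 1 1 + def1x n 0 0 0 + def1x n 1 1 1))).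
    have eC := dilated_rec0 n; rewrite -!moment_a0 in eC.
    by rewrite /defJ /def1x /nonrec_step /M [n.+2.-1]/= eC /d; ring.
  by rewrite !(defJ0, def1x0); ring.
(* The defects below, weighted by z^(n + 2 - index), are the cofactors that turn
   l (k^(h+1) C (x^(h+1) J^(h+2))), which [moment_rec] computes for the operator
   C of the symmetric equation, into the recursion for M. *)
transitivity (M n.+1 h.+2 + M n.+1 h.+1 + nonrec_step (M n.+1) h.+1
  + c * (nonrec_step (M n) h.+2 + nonrec_step (M n) h.+1)
  - (defJ n.+2 h.+1 h.+1 h.+1
     - h.+1%:R * (defkJ n.+1 h h h + 2%:R * defkJ n.+1 h.+1 h.+1 h.+1
                  + defkJ n.+1 h.+2 h.+2 h.+2)
     - h.+1%:R * (def1x n.+1 h.+1 h h.+2 + def1x n.+1 h.+1 h.+1 h.+2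
                  + def1x n.+1 h.+1 h h.+1 + def1x n.+1 h.+2 h.+1 h.+2)
     - c * (def1x n h.+1 h.+1 h.+2 + def1x n h.+1 h.+2 h.+2
            + def1x n h.+1 h.+1 h.+1 + def1x n h.+2 h.+2 h.+2)
     + h.+1%:R * (defJ n.+1 h.+1 h h.+2 + 2%:R * defJ n.+1 h.+1 h.+1 h.+2
                  + defJ n.+1 h.+1 h.+2 h.+2)
     - def1x n.+1 h.+1 h.+1 h.+1 - d * defkJ n.+1 h h h
     - d * defJ n.+1 h.+1 h h.+1)).
  rewrite /defJ /def1x /defkJ /nonrec_step /M [n.+2.-1]/= [n.+1.-1]/=.
  by rewrite (moment_rec n h.+1 h h.+2) /d; ring.
by rewrite !(defJ0, def1x0, defkJ0); ring.
Qed.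

Lemma subst_hist0 n : M n 0 = sym_hist q t n 0.
Proof. exact: dilated_b0. Qed.

Lemma subst_hist_n0 h : M 0 h = 0.
Proof. exact: moment_n0. Qed.

Lemma subst_hist_n1 h : M 1 h = (h == 0)%:R.
Proof. exact: moment_n1. Qed.
End SymmetricHistories.

(** * Laguerre histories as words *)

Definition letter := (bool * bool * nat)%type.
Definition rec_letter (l : letter) := l.1.1 && (l.2 == 0).
Definition ear_letter (l : letter) := [&& ~~ l.1.1, l.1.2 & l.2 == 0].

(** The flag tells whether the preceding letter is a record; a final record makes no drop. *)
Fixpoint rec_drops (b : bool) (w : seq letter) : nat :=
  if w is l :: w1 then (b && ~~ rec_letter l) + rec_drops (rec_letter l) w1
  else 0.

(* The first two components of a letter encode the step of the path:
   (true, false) goes up, (false, true) goes down, and the two others keep the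
   height. A fixed point has type (true, true) and its code is the height. *)
Definition letters (h : nat) : seq letter :=
  [seq ((ef, c) : letter)
     | ef <- [:: (true, false); (true, true); (false, false); (false, true)],
       c <- iota 0 (h + ef.1)].

Fixpoint words (n h : nat) : seq (seq letter) :=
  if n is n1.+1 then
    [seq l :: w | l : letter <- letters h,
                  w : seq letter <- words n1 (h + l.1.1 - l.1.2)]
  else if h == 0 then [:: [::]] else [::].

Section WordGenerating.
Local Open Scope ring_scope.

Lemma sum_iota_eq (V : nmodType) (F : nat -> V) m k :
  (forall c, (0 < c)%N -> F c = F 1%N) -> (0 < m)%N ->
  \sum_(c <- iota m k) F c = F 1%N *+ k.
Proof.
move=> FE; elim: k m => [|k IH] m m0; first by rewrite big_nil.
by rewrite big_cons IH // FE // mulrS.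
Qed.

Variables (R : comNzRingType) (q t : R).

Definition word_gf (b : bool) (n h : nat) : R :=
  \sum_(w <- words n h) q ^+ rec_drops b w * t ^+ count ear_letter w.

Lemma word_gf0 b h : word_gf b 0 h = (h == 0%N)%:R.
Proof.
rewrite /word_gf /=; case: eqP => _; rewrite ?big_nil //.
by rewrite big_seq1 /= mulr1.
Qed.

Lemma word_gf_letters b n h : word_gf b n.+1 h =
  \sum_(l <- letters h) q ^+ (b && ~~ rec_letter l) * t ^+ ear_letter l
    * word_gf (rec_letter l) n (h + l.1.1 - l.1.2).
Proof.
rewrite {1}/word_gf big_allpairs_dep; apply: eq_bigr => l _.
by rewrite /word_gf big_distrr; apply: eq_bigr => w _ /=; rewrite !exprD; ring.
Qed.

Lemma word_gfS b n h : word_gf b n.+1 h =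
  word_gf true n h.+1 + word_gf true n h
  + (if b then q else 1) * nonrec_step t (word_gf false n) h.
Proof.
have qb : q ^+ b = if b then q else 1 by case: b; rewrite ?expr1 ?expr0.
rewrite word_gf_letters /letters big_allpairs_dep !big_cons big_nil.
rewrite [LHS]/= !addn0 !addn1 !subn0 !subn1 [iota 0 h.+1]/= !big_cons.
rewrite /nonrec_step; case: h => [|h]; rewrite /rec_letter /ear_letter /=.
  by rewrite !big_nil eqxx andbF /= !expr0; ring.
rewrite !big_cons !sum_iota_eq //; try by case.
by rewrite /= ?andbF ?andbT !expr0 ?expr1 qb; ring.
Qed.

(** The flag [true] only multiplies a next non-record step by q; eliminating it yields the term c
    z^2 N X. *)
Lemma word_gf_subst_hist n h :
  word_gf false n h = subst_hist q t n.+1 h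
  /\ word_gf true n h
     = subst_hist q t n.+1 h + (q - 1) * nonrec_step t (subst_hist q t n) h.
Proof.
elim: n h => [|n IH] h.
  rewrite !word_gf0 subst_hist_n1 /nonrec_step !subst_hist_n0.
  by split=> //; case: h => [|h]; rewrite ?subst_hist_n0; ring.
have gf_false : word_gf false n =1 subst_hist q t n.+1 by move=> h'; case: (IH h').
have nonrec_gf :
    nonrec_step t (word_gf false n) h = nonrec_step t (subst_hist q t n.+1) h.
  by rewrite /nonrec_step !gf_false; case: h => [|h]; rewrite ?gf_false.
rewrite !word_gfS subst_hist_rec nonrec_gf (IH h).2 (IH h.+1).2.
by split; ring.
Qed.

Lemma word_gf_sym_hist n : word_gf false n 0 = sym_hist q t n.+1 0.
Proof. by rewrite (word_gf_subst_hist n 0).1 subst_hist0. Qed.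
End WordGenerating.

(** At q = t = 1 the generating function counts words, and n! C(n, h) solves its recursion. *)
Lemma size_words n h : size (words n h) = n`! * 'C(n, h).
Proof.
have gf1 b : (word_gf (1 : int) 1 b n h = (n`! * 'C(n, h))%:R)%R.
  elim: n h b => [|n IH] h b.
    by rewrite word_gf0 bin0n fact0 mul1n.
  rewrite word_gfS /nonrec_step !IH if_same mul1r.
  have sum0 h' : (n - h') * 'C(n, h') = h'.+1 * 'C(n, h'.+1).
    by rewrite mul_bin_left.
  case: h => [|h].
    by rewrite !mul0r !addr0 -natrD !bin0 !bin1 factS; congr (1 *+ _)%R; nia.
  rewrite !IH natr1 -!natrM -!natrD factS binS; congr (1 *+ _)%R.
  have sum0D h' : n * 'C(n, h') = h'.+1 * 'C(n, h'.+1) + h' * 'C(n, h').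
    have [le_hn|lt_nh] := leqP h' n; last by rewrite !bin_small ?muln0 // ltnW.
    by rewrite -sum0 -mulnDl subnK.
  have := sum0D h; have := sum0D h.+1.
  move: 'C(n, h) 'C(n, h.+1) 'C(n, h.+2) n`! => C0 C1 C2 f e1 e0.
  transitivity (f * (h.+2 * C2 + (h.+1 * 2).+1 * C1 + h.+1 * C0)); first by ring.
  transitivity (f * (n.+1 * (C1 + C0))); last by ring.
  by congr (_ * _); lia.
have := gf1 false; rewrite /word_gf.
under eq_bigr do rewrite !expr1n mulr1.
rewrite big_const_seq count_predT iter_addr addr0.
by move/eqP; rewrite Num.Theory.eqr_nat => /eqP.
Qed.

(** * Encoding permutations as words *)

Section Encoding.
Variable n : nat.
Implicit Types (s : 'S_n) (i : 'I_n).

(** Inversions to the left at weak excedances and to the right elsewhere: code 0 then detects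
    records, respectively antirecords. *)
Definition code s i : nat :=
  if i <= s i then #|[set v : 'I_n | (s i < v) && ((s^-1)%g v < i)]|
  else #|[set v : 'I_n | (v < s i) && (i < (s^-1)%g v)]|.

Definition letter_at s i : letter := (i <= s i, (s^-1)%g i <= i, code s i).

Definition enc s : seq letter := [seq letter_at s i | i <- enum 'I_n].

Definition height s k := #|[set v : 'I_n | (v < k) && (k <= (s^-1)%g v)]|.

Lemma size_enc s : size (enc s) = n.
Proof. by rewrite size_map size_enum_ord. Qed.

Lemma nth_enc l s i : nth l (enc s) i = letter_at s i.
Proof. by rewrite (nth_map i) ?size_enum_ord // nth_ord_enum. Qed.

Lemma card_set_sum (T : finType) (P : pred T) : #|[set x | P x]| = \sum_x P x.
Proof.
rewrite -sum1_card big_mkcond; apply: eq_bigr => x _; rewrite inE.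
by case: (P x).
Qed.

Lemma sum_eq_pred (T : finType) (y : T) (P : pred T) : \sum_x (x == y) * P x = P y.
Proof.
rewrite (bigD1 y) //= eqxx mul1n big1 ?addn0 // => x /negbTE ->.
by rewrite mul0n.
Qed.

Lemma height_step s i :
  height s i.+1 + ((s^-1)%g i <= i) = height s i + (i <= s i).
Proof.
suff : height s i.+1 + (s i < i) = height s i + (i < (s^-1)%g i).
  by have [] := leqP i (s i); have [] := leqP ((s^-1)%g i) i; lia.
rewrite /height !card_set_sum.
rewrite -(sum_eq_pred (s i) (fun v => v < i)).
rewrite -(sum_eq_pred i (fun v => i < (s^-1)%g v)) -!big_split /=.
apply: eq_bigr => v _.
have -> : (v == s i) = ((s^-1)%g v == i :> nat).
  by rewrite val_eqE (can2_eq (permKV s) (permK s)).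
have -> : (v == i) = (v == i :> nat) by [].
lia.
Qed.

(** There are as many positions as values below k; both sides omit the pairs with both below k. *)
Lemma card_ge_lt s k :
  #|[set v : 'I_n | (k <= v) && ((s^-1)%g v < k)]| = height s k.
Proof.
rewrite /height !card_set_sum.
apply/eqP; rewrite -(eqn_add2r (\sum_(v : 'I_n) ((v < k) && ((s^-1)%g v < k)))).
rewrite -!big_split /=.
apply/eqP; transitivity (\sum_(v : 'I_n) ((s^-1)%g v < k)).
  by apply: eq_bigr => v _; lia.
transitivity (\sum_(v : 'I_n) (v < k)); last by apply: eq_bigr => v _; lia.
by rewrite [RHS](reindex_inj (@perm_inj _ (s^-1)%g)).
Qed.

Lemma code_bound s i : code s i < height s i + (i <= s i).
Proof.
rewrite /code; case: (leqP i (s i)) => [le_is|lt_si]; last first.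
  rewrite /= addn0 /height; apply: proper_card; apply/properP; split.
    by apply/subsetP => v; rewrite !inE; lia.
  by exists (s i); rewrite !inE ?permK ?lt_si ?leqnn // ltnn.
rewrite /= addn1 ltnS -card_ge_lt; apply: subset_leq_card.
by apply/subsetP => v; rewrite !inE; lia.
Qed.

Lemma drop_enc_words s k m : k + m = n -> drop k (enc s) \in words m (height s k).
Proof.
elim: m k => [|m IH] k kmn.
  rewrite drop_oversize ?size_enc; last by lia.
  rewrite (_ : height s k = 0) ?inE //; apply: eq_card0 => v.
  by rewrite !inE; have := ltn_ord ((s^-1)%g v); lia.
have ltkn : k < n by lia.
pose i : 'I_n := Ordinal ltkn.
have szi : k < size (enum 'I_n) by rewrite size_enum_ord.
rewrite (drop_nth (letter_at s i)) ?size_enc // [X in X :: _](nth_map i) //.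
rewrite -[k in nth i _ k]/(val i) nth_ord_enum.
have := IH k.+1; rewrite addSn -addnS => /(_ kmn) mem_tl.
have hS : height s k + (letter_at s i).1.1 - (letter_at s i).1.2 = height s k.+1.
  by apply/esym; apply: (canRL (addnK _) (height_step s i)).
apply/allpairsPdep; exists (letter_at s i), (drop k.+1 (enc s)).
rewrite hS; split=> //.
apply/allpairsPdep; exists (i <= s i, (s^-1)%g i <= i), (code s i).
split=> //; first by do 2!case: (_ <= _).
by rewrite mem_iota add0n /=; have := code_bound s i.
Qed.

Lemma enc_words s : enc s \in words n 0.
Proof.
have := @drop_enc_words s 0 n (add0n n); rewrite drop0.
by rewrite (_ : height s 0 = 0) //; apply: eq_card0 => v; rewrite !inE.
Qed.

(* The values s i with i <= s i are recovered from the letters by decreasing i,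
   those with s i < i by increasing i. *)
Lemma exc_code_ltn s s' i :
    (forall j : 'I_n, (j <= s j) = (j <= s' j)) ->
    (forall j : 'I_n, ((s^-1)%g j <= j) = ((s'^-1)%g j <= j)) ->
    i <= s i -> (forall j : 'I_n, i < j -> j <= s j -> s j = s' j) ->
  s i < s' i -> code s' i < code s i.
Proof.
move=> eE fE ei same lt_ss'; rewrite /code -eE ei.
apply: proper_card; apply/properP; split.
  apply/subsetP => v; rewrite !inE => /andP[lt_v lt_i].
  rewrite (ltn_trans lt_ss' lt_v) /=.
  (* If s placed v after i, it would be at a weak excedance, where s and s' agree. *)
  have fv : (s^-1)%g v <= v by rewrite fE; lia.
  have [//|lt_ij|eq_ij] := ltngtP ((s^-1)%g v) i.
    have := same _ lt_ij; rewrite permKV => /(_ fv) eqv.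
    by move: lt_i; rewrite eqv permK; lia.
  by have := permKV s v; rewrite (val_inj eq_ij) => ev; move: lt_v; rewrite -ev; lia.
exists (s' i); rewrite !inE ?ltnn // lt_ss' /=.
have fv : (s^-1)%g (s' i) <= s' i by rewrite fE permK -eE.
have [//|lt_ij|eq_ij] := ltngtP ((s^-1)%g (s' i)) i.
  have := same _ lt_ij; rewrite permKV => /(_ fv) /perm_inj eqv.
  by move: lt_ij; rewrite -eqv ltnn.
have := permKV s (s' i); rewrite (val_inj eq_ij) => ev.
by move: lt_ss'; rewrite -ev ltnn.
Qed.

Lemma drop_code_ltn s s' i :
    (forall j : 'I_n, (j <= s j) = (j <= s' j)) ->
    (forall j : 'I_n, ((s^-1)%g j <= j) = ((s'^-1)%g j <= j)) ->
    s i < i -> (forall j : 'I_n, j < i -> s j < j -> s j = s' j) ->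
  s i < s' i -> code s i < code s' i.
Proof.
move=> eE fE ei same lt_ss'; rewrite /code -eE (leqNgt i) ei /=.
apply: proper_card; apply/properP; split.
  apply/subsetP => v; rewrite !inE => /andP[lt_v lt_i].
  rewrite (ltn_trans lt_v lt_ss') /=.
  have fv : v < (s'^-1)%g v by rewrite ltnNge -fE; lia.
  have sv : s ((s'^-1)%g v) < (s'^-1)%g v by rewrite ltnNge eE permKV; lia.
  have [lt_ij|//|eq_ij] := ltngtP ((s'^-1)%g v) i.
    have := same _ lt_ij sv; rewrite permKV => eqv.
    by move: lt_i; rewrite -eqv permK; lia.
  by have := permKV s' v; rewrite (val_inj eq_ij) => ev; move: lt_v; rewrite -ev; lia.
exists (s i); rewrite !inE ?ltnn // lt_ss' /=.
have fv : s i < (s'^-1)%g (s i) by rewrite ltnNge -fE permK; lia.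
have sv : s ((s'^-1)%g (s i)) < (s'^-1)%g (s i) by rewrite ltnNge eE permKV; lia.
have [lt_ij|//|eq_ij] := ltngtP ((s'^-1)%g (s i)) i.
  have := same _ lt_ij sv; rewrite permKV => /perm_inj eqv.
  by move: lt_ij; rewrite eqv ltnn.
have := permKV s' (s i); rewrite (val_inj eq_ij) => ev.
by move: lt_ss'; rewrite -ev ltnn.
Qed.

Lemma enc_inj : injective enc.
Proof.
move=> s s' eq_enc.
have letE i : letter_at s i = letter_at s' i.
  by have := congr1 (fun w => nth (letter_at s i) w i) eq_enc; rewrite !nth_enc.
have eE i : (i <= s i) = (i <= s' i) by case: (letE i).
have fE i : ((s^-1)%g i <= i) = ((s'^-1)%g i <= i) by case: (letE i).
have cE i : code s i = code s' i by case: (letE i).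
have excE m (i : 'I_n) : n - i <= m -> i <= s i -> s i = s' i.
  elim: m i => [|m IH] i; first by have := ltn_ord i; lia.
  move=> le_m ei.
  have same (j : 'I_n) : i < j -> j <= s j -> s j = s' j.
    by move=> lt_ij; apply: IH; have := ltn_ord i; lia.
  have [lt_ss'|lt_s's|/val_inj //] := ltngtP (s i) (s' i).
    by have := exc_code_ltn eE fE ei same lt_ss'; rewrite cE ltnn.
  have := @exc_code_ltn s' s i (fun j => esym (eE j)) (fun j => esym (fE j)).
  rewrite cE ltnn -eE => /(_ ei) H; suff : false by []; apply: H lt_s's => j lt_ij ej.
  by rewrite same ?eE.
have dropE m (i : 'I_n) : i < m -> s i < i -> s i = s' i.
  elim: m i => [|m IH] i //.
  move=> le_m ei.
  have same (j : 'I_n) : j < i -> s j < j -> s j = s' j.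
    by move=> lt_ji; apply: IH; lia.
  have [lt_ss'|lt_s's|/val_inj //] := ltngtP (s i) (s' i).
    by have := drop_code_ltn eE fE ei same lt_ss'; rewrite cE ltnn.
  have := @drop_code_ltn s' s i (fun j => esym (eE j)) (fun j => esym (fE j)).
  rewrite cE ltnn ltnNge -eE -ltnNge => /(_ ei) H; suff : false by [].
  by apply: H lt_s's => j lt_ij ej; rewrite same // ltnNge eE -ltnNge.
apply/permP => i; have [ei|ei] := leqP i (s i).
  exact: (excE _ i (leqnn _) ei).
exact: (dropE _ i (ltnSn _) ei).
Qed.

(* Surjectivity of enc comes from counting: there are n! words of length n. *)
Lemma perm_enc_words : perm_eq [seq enc s | s : 'S_n] (words n 0).
Proof.
have uniq_enc : uniq [seq enc s | s : 'S_n].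
  by rewrite map_inj_uniq ?enum_uniq //; exact: enc_inj.
have sub_enc : {subset [seq enc s | s : 'S_n] <= words n 0}.
  by move=> _ /mapP[s _ ->]; apply: enc_words.
have le_size : size (words n 0) <= size [seq enc s | s : 'S_n].
  by rewrite size_words bin0 muln1 size_map -cardE card_Sn.
have [eq_size eq_mem] := uniq_min_size uniq_enc sub_enc le_size.
apply: uniq_perm => //.
by rewrite -(eq_uniq eq_size eq_mem).
Qed.

(** * Statistics read off the letters *)

Lemma rec_letter_at s i : rec_letter (letter_at s i) = record s i.
Proof.
rewrite /rec_letter /= /code.
apply/andP/forallP => [[ei] | rec_i].
  rewrite ei cards_eq0 => /eqP A0 j; apply/implyP => lt_ji.
  have := in_set0 (s j); rewrite -A0 inE permK lt_ji andbT => /negbT.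
  rewrite -leqNgt leq_eqVlt => /orP[/eqP/val_inj/perm_inj eq_ji|//].
  by move: lt_ji; rewrite eq_ji ltnn.
(* The i + 1 values at indices up to i are all at most s i. *)
have ei : i <= s i.
  have sub : [set s j | j in [set j : 'I_n | j <= i]] \subset [set v : 'I_n | v <= s i].
    apply/subsetP => _ /imsetP[j + ->]; rewrite !inE leq_eqVlt.
    case/orP=> [/eqP/val_inj -> //|lt_ji].
    by apply: ltnW; have /implyP := rec_i j; apply.
  have card_le k : k < n -> #|[set j : 'I_n | j <= k]| = k.+1.
    move=> lt_kn; rewrite cardsE -sum1_card.
    rewrite (eq_bigl (fun j : 'I_n => (j < k.+1))) //.
    by rewrite -(big_ord_widen _ (fun=> 1)) // sum1_card card_ord.
  have := subset_leq_card sub; rewrite card_imset; last exact: perm_inj.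
  by rewrite !card_le.
rewrite ei cards_eq0; split=> //; apply/eqP/setP => v; rewrite !inE.
apply/negP => /andP[lt_v lt_i].
by have /implyP/(_ lt_i) := rec_i ((s^-1)%g v); rewrite permKV; lia.
Qed.

Lemma ear_letter_at s i :
  ear_letter (letter_at s i) = excl_antirecord_cycle_peak s i.
Proof.
rewrite /ear_letter /excl_antirecord_cycle_peak /cycle_peak -rec_letter_at /rec_letter /=.
rewrite -ltnNge (ltn_neqAle ((s^-1)%g i)); case: (ltnP (s i) i) => //= lt_si.
(* Since s i < i, i is not fixed, so the weak inequality in the letter is strict. *)
have -> : (s^-1)%g i != i :> nat.
  by apply/eqP => /val_inj ei; move: lt_si; rewrite -{1}ei permKV ltnn.
congr (_ && _); rewrite andbT /code (leqNgt i) lt_si /= cards_eq0.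
apply/eqP/forallP => [A0 j | anti].
  apply/implyP => lt_ij.
  have := in_set0 (s j); rewrite -A0 inE permK lt_ij andbT => /negbT.
  rewrite -leqNgt leq_eqVlt => /orP[/eqP/val_inj/perm_inj eq_ji|//].
  by move: lt_ij; rewrite eq_ji ltnn.
apply/setP => v; rewrite !inE; apply/negP => /andP[lt_v lt_i].
by have /implyP/(_ lt_i) := anti ((s^-1)%g v); rewrite permKV; lia.
Qed.

Lemma ear_enc s : count ear_letter (enc s) = ear s.
Proof.
rewrite count_map -sum1_count big_enum_cond /ear cardsE -sum1_card.
by apply: eq_bigl => i; rewrite /= ear_letter_at.
Qed.

Lemma rec_drops_nth b w : rec_drops b w =
  \sum_(i < size w) (nth false (b :: map rec_letter w) i
                     && ~~ nth false (map rec_letter w) i).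
Proof.
elim: w b => [|l w IH] b; first by rewrite big_ord0.
by rewrite /= big_ord_recl IH.
Qed.

End Encoding.

(** After a record i, the index i + 1 is a record unless i is a descent. *)
Lemma rec_drops_enc n (s : 'S_n) : rec_drops false (enc s) = des2 s.
Proof.
rewrite rec_drops_nth size_enc /des2 card_set_sum.
have nth_rec (i : 'I_n) : nth false (map rec_letter (enc s)) i = record s i.
  by rewrite (nth_map (letter_at s i)) ?size_enc // nth_enc rec_letter_at.
case: n s nth_rec => [|m] s nth_rec; first by rewrite !big_ord0.
rewrite big_ord_recl [RHS]big_ord_recr /= add0n addnC.
have -> : descent2 s ord_max = false.
  apply/negbTE; rewrite negb_and; apply/orP; left; apply/existsPn => j.
  by rewrite /= (ltn_eqF (ltn_ord j)).
rewrite add0n; apply: eq_bigr => i _; congr nat_of_bool.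
rewrite -[bump 0 i]/(nat_of_ord (lift ord0 i)) nth_rec.
rewrite -[nat_of_ord i in LHS]/(nat_of_ord (widen_ord (leqnSn m) i)) nth_rec.
rewrite /descent2 [RHS]andbC.
case rec_i: (record s (widen_ord _ i)) => //=.
apply/idP/existsP => [not_rec|[j /andP[/eqP eq_j lt_sj]]].
  exists (lift ord0 i); rewrite eqxx /=; apply: contraR not_rec; rewrite -leqNgt => le_s.
  apply/forallP => j; apply/implyP; rewrite /= /bump leq0n add1n ltnS leq_eqVlt.
  have lt_s : s (widen_ord (leqnSn m) i) < s (lift ord0 i).
    rewrite ltn_neqAle le_s andbT; apply/eqP => /val_inj/perm_inj/(congr1 val) /=.
    by rewrite /bump leq0n; lia.
  case/orP => [/eqP eq_j|lt_ji].
    by rewrite (_ : j = widen_ord (leqnSn m) i) //; apply: val_inj.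
  by apply: ltn_trans lt_s; have /forallP/(_ j)/implyP := rec_i; apply.
apply/negP => /forallP/(_ (widen_ord (leqnSn m) i))/implyP /=.
rewrite /bump leq0n add1n => /(_ (leqnn _)).
have -> : lift ord0 i = j by apply: val_inj; rewrite /= eq_j.
by move: lt_sj; lia.
Qed.

(** * Transfer of the symmetry to permutations *)

Section Distribution.
Local Open Scope ring_scope.

Lemma des2_ear_words (R : comNzRingType) (q t : R) n :
  \sum_(s : 'S_n) q ^+ des2 s * t ^+ ear s = word_gf q t false n 0.
Proof.
rewrite /word_gf -(perm_big _ (@perm_enc_words n)) /= big_map big_enum /=.
by apply: eq_bigr => s _; rewrite rec_drops_enc ear_enc.
Qed.
End Distribution.

Local Open Scope ring_scope.

Theorem mainTheorem2 (n : nat) (hn : (1 <= n)%N) :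
  \sum_(s : 'S_n) var_q ^+ des2 s * var_t ^+ ear s
  = \sum_(s : 'S_n) var_q ^+ ear s * var_t ^+ des2 s.
Proof.
rewrite des2_ear_words word_gf_sym_hist sym_hist_sym -word_gf_sym_hist.
by rewrite -des2_ear_words; apply: eq_bigr => s _; rewrite mulrC.
Qed.
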